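(* Let $f$ be a positive integer-valued function on $V(G)$ and let $\varepsilon$ be a real number with $0<\varepsilon\le 1$. Let $G$ be a $t$-iso-tough graph where $t(v)=f(v)(f(v)+1)/\varepsilon$ for each vertex $v$. If for all $S\subseteq V(G)$ $$\omega(G\setminus S)<\sum_{v\in S}\big(f(v)-\varepsilon\big)+2,$$ then $G$ has a near $f$-factor.
   Context: Graphs are finite, have no loops, but may have multiple edges; degrees count multiplicities. For $S\subseteq V(G)$, $G\setminus S$ is the graph obtained by deleting $S$, $\omega(\cdot)$ is the number of connected components, and $I(G\setminus S)$ is the set of isolated vertices of $G\setminus S$. For a real function $t$ on $V(G)$, $G$ is $t$-iso-tough if $\sum_{v\in I(G\setminus S)}t(v)\le |S|$ for all $S\subseteq V(G)$. A near $f$-factor is a spanning subgraph $F$ with $d_F(v)=f(v)$ for all vertices $v$, except for at most one vertex $u$ with $d_F(u)=f(u)+1$. *)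

(* Defs.v *)
From HB Require Import structures.
From mathcomp Require Import all_boot all_order all_algebra.
Set Implicit Arguments. Unset Strict Implicit. Unset Printing Implicit Defensive.
Import Order.TTheory GRing.Theory Num.Theory.

(* A finite loopless multigraph on vertex set T is given by an edge
   multiplicity function m : T -> T -> nat, symmetric with m x x = 0. *)
Definition multigraph (T : finType) (m : T -> T -> nat) : Prop :=
  (forall x y, m x y = m y x) /\ (forall x, m x x = 0%N).

Definition deg (T : finType) (m : T -> T -> nat) (v : T) : nat :=
  (\sum_(u : T) m v u)%N.

Definition adj_del (T : finType) (m : T -> T -> nat) (S : {set T}) : rel T :=
  fun x y => [&& x \notin S, y \notin S & (0 < m x y)%N].

Definition ncomp_del (T : finType) (m : T -> T -> nat) (S : {set T}) : nat :=
  n_comp (adj_del m S) (~: S).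

Definition iso_del (T : finType) (m : T -> T -> nat) (S : {set T}) : {set T} :=
  [set v | (v \notin S) && [forall u, (0 < m v u)%N ==> (u \in S)]].

Definition iso_tough (R : realFieldType) (T : finType) (m : T -> T -> nat)
  (t : T -> R) : Prop :=
  forall S : {set T}, (\sum_(v in iso_del m S) t v <= (#|S|%:R : R))%R.

Definition spanning_sub (T : finType) (m F : T -> T -> nat) : Prop :=
  multigraph F /\ (forall x y, F x y <= m x y)%N.

Definition near_factor (T : finType) (m : T -> T -> nat) (f : T -> nat) : Prop :=
  exists F : T -> T -> nat, spanning_sub m F /\
    ((forall v, deg F v = f v) \/
     (exists u, deg F u = (f u).+1 /\ forall v, v != u -> deg F v = f v)).

(* Main.v *)
Require Import Defs.
From HB Require Import structures.
From mathcomp Require Import all_boot all_order all_algebra all_fingroup.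
From mathcomp Require Import fingraph zify.
Set Implicit Arguments. Unset Strict Implicit. Unset Printing Implicit Defensive.
Import Order.TTheory GRing.Theory Num.Theory.

(* Near f-factors correspond to perfect matchings of a gadget graph, so by Tutte's
   theorem (proved here through Gallai's lemma) a graph without a near f-factor has
   a barrier in the gadget. A barrier of least cardinality comes from disjoint vertex
   sets S and T such that
     f(S) + sum_{v in T} d_{G-S}(v) + 2 <= f(T) + omega(G - (S u T))
   and d_T(v) + 2 <= f(v) for v in T. Let U consist of the v in T with
   d_{G-S}(v) >= 2 f(v), and let W = T - U. Putting the vertices of W back into
   G - (S u T) one at a time gives
     f(S) + f(U) + 2 <= f(W) + omega(G - (S u U)),
   so the hypothesis on components yields eps |S| < f(W). On the other hand, let I
   be an independent subset of W chosen greedily by decreasing f. Then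
     f(W) <= sum_{v in I} f(v) (1 + d_W(v)) <= sum_{v in I} f(v) (f(v) - 1),
   and as I is isolated once S and the neighbours of I are deleted, iso-toughness
   gives sum_{v in I} f(v) (f(v) + 1) <= eps |S| + sum_{v in I} d_{G-S}(v), where
   d_{G-S}(v) < 2 f(v); hence f(W) <= eps |S|. *)

(** * The Tutte-Berge formula *)

Lemma odd_sum (I : finType) (P : pred I) (F : I -> nat) :
  odd (\sum_(i | P i) F i) = odd #|[pred i | P i && odd (F i)]|.
Proof.
rewrite -sum1_card [in RHS](eq_bigl (fun i => P i && odd (F i))) // big_mkcondr.
apply: (big_ind2 (fun a b : nat => odd a = odd b)) => // [a b c d|i _].
  by rewrite !oddD => -> ->.
by case: (odd (F i)).
Qed.

(** The points moved by [M] fall into pairs: [L] takes the member of smaller [enum_rank] from each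
    pair, and [M] maps [L] onto the other members [L']. *)
Lemma odd_card_involution (V : finType) (M : V -> V) (K : {set V}) :
  involutive M -> {in K, forall x, M x \in K} ->
  odd #|K| = odd #|[set x in K | M x == x]|.
Proof.
move=> MK KM.
pose L := [set x in K | (enum_rank x < enum_rank (M x))%N].
pose L' := [set x in K | (enum_rank (M x) < enum_rank x)%N].
have LL' : L' = M @: L.
  apply/setP=> x; apply/idP/imsetP => [|[y]].
    rewrite inE => /andP[xK lt]; exists (M x); last by rewrite MK.
    by rewrite inE KM // MK.
  by rewrite inE => /andP[yK lt] ->; rewrite inE KM // MK.
have cL : #|L'| = #|L| by rewrite LL' card_imset //; apply: inv_inj.
pose Fx := [set x in K | M x == x].
have rankE x : (nat_of_ord (enum_rank (M x)) == enum_rank x) = (M x == x).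
  by apply/eqP/eqP => [/val_inj/enum_rank_inj|->].
have -> : #|K| = (#|Fx| + (#|L| + #|L'|))%N.
  rewrite -(cardsID Fx K); congr (_ + _)%N.
    by apply: eq_card => x; rewrite !inE andbA andbb.
  rewrite -(cardsID L (K :\: Fx)); congr (_ + _)%N; apply: eq_card => x; rewrite !inE.
    by case: (x \in K) => //=; rewrite andbT ltn_neqAle [nat_of_ord _ == _]eq_sym rankE andbA andbb.
  by case: (x \in K) => //=; rewrite ?andbT ?andbF // -leqNgt andbC [RHS]ltn_neqAle rankE.
by rewrite cL addnn oddD odd_double addbF.
Qed.

(** * Odd components of induced subgraphs, and maximum matchings *)

Section Graph.
Variables (V : finType) (e : rel V).
Hypothesis e_sym : symmetric e.
Implicit Types (X Y A B R : {set V}) (M N : {perm V}).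

Definition induced X : rel V := fun x y => [&& x \in X, y \in X & e x y].
Definition comp X x : {set V} := [set y | connect (induced X) x y].
(** Each odd component is recorded by its canonical [root], so that counting components becomes
    taking the cardinality of a vertex set. *)
Definition odd_roots X : {set V} :=
  [set r in X | (root (induced X) r == r) && odd #|comp X r|].
Definition oddc X : nat := #|odd_roots X|.

Lemma induced_sym X : symmetric (induced X).
Proof. by move=> x y; rewrite /induced e_sym andbCA. Qed.

Lemma induced_connect_sym X : connect_sym (induced X).
Proof. exact/sym_connect_sym/induced_sym. Qed.

Lemma induced_connect_in X x y : x \in X -> connect (induced X) x y -> y \in X.
Proof.
move=> xX /connectP[p]; elim: p x xX => [|z p IH] x xX /= => [_ -> //|].
by case/andP=> /and3P[_ zX _] pz /IH; apply.
Qed.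

Lemma comp_eq X x y : connect (induced X) x y -> comp X x = comp X y.
Proof.
by move=> cxy; apply/setP=> z; rewrite !inE (same_connect (induced_connect_sym X) cxy).
Qed.

(** [X] is partitioned by its components, and modulo 2 only the odd ones contribute to its size. *)
Lemma odd_oddc X : odd (oddc X) = odd #|X|.
Proof.
have -> : #|X| = \sum_(r in X | root (induced X) r == r) #|comp X r|.
  rewrite -sum1_card (partition_big (root (induced X))
    (fun r => (r \in X) && (root (induced X) r == r))) /=.
    apply: eq_bigr => r /andP[rX /eqP rr]; rewrite -sum1_card; apply: eq_bigl => y.
    rewrite inE; apply/andP/idP => [[yX /eqP yr]|cry].
      by rewrite induced_connect_sym -yr connect_root.
    split; first exact: induced_connect_in cry.
    by rewrite -rr; apply/eqP/esym/(rootP (induced_connect_sym X)).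
  move=> y yX; rewrite root_root ?eqxx ?andbT; last exact: induced_connect_sym.
  exact/(induced_connect_in yX)/connect_root.
rewrite odd_sum; congr odd; apply: eq_card => r.
by rewrite !inE andbA.
Qed.

(** Serves to bound [oddc] from above by exhibiting a set [R] that meets every odd component. *)
Lemma oddc_leq_card Y R :
  {in Y, forall y, odd #|comp Y y| -> exists2 r, r \in R & connect (induced Y) y r} ->
  (oddc Y <= #|R|)%N.
Proof.
move=> hR; apply: leq_trans (leq_imset_card (root (induced Y)) R).
apply/subset_leq_card/subsetP => y; rewrite inE => /and3P[yY /eqP yr yo].
have [r rR cyr] := hR y yY yo; apply/imsetP; exists r => //.
by rewrite -{1}yr; apply/(rootP (induced_connect_sym Y)).
Qed.

(* A component of [Y] that is not adjacent to [B] remains a component of [Y :|: B]. *)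
Lemma oddc_setU Y B R :
  (forall b y, b \in B -> y \in Y -> e b y ->
     exists2 r, r \in R & connect (induced Y) y r) ->
  (oddc Y <= oddc (Y :|: B) + #|R|)%N.
Proof.
move=> hR; pose Z := Y :|: B.
have sYZ : subrel (connect (induced Y)) (connect (induced Z)).
  apply: connect_sub => x y /and3P[xY yY exy]; apply: connect1.
  by rewrite /induced !inE xY yY.
(* [D] collects the roots of the components met by [R]; by [hR] all other components are not
   adjacent to [B], so they are unchanged in [Z]. *)
pose D := root (induced Y) @: R.
have cD : (#|odd_roots Y :&: D| <= #|R|)%N.
  by apply: leq_trans (leq_imset_card (root (induced Y)) R); rewrite subset_leq_card ?subsetIr.
rewrite /oddc -(cardsID D (odd_roots Y)) addnC leq_add //.
have same r : r \in odd_roots Y :\: D -> comp Z r = comp Y r.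
  rewrite !inE => /and3P[rD rY /andP[/eqP rr _]].
  apply/setP=> y; rewrite !inE; apply/idP/idP; last exact: sYZ.
  case/connectP=> p; elim/last_ind: p y => [|p z IH] y /= => [_ ->//|].
  rewrite last_rcons rcons_path => /andP[pp /and3P[lZ zZ elz]] ->.
  have crl := IH _ pp erefl; have lY := induced_connect_in rY crl.
  have [zY|zY] := boolP (z \in Y).
    by apply: connect_trans crl (connect1 _); rewrite /induced lY zY.
  have zB : z \in B by move: zZ; rewrite inE (negPf zY).
  have [s sR cls] := hR z _ zB lY (etrans (e_sym _ _) elz).
  case/negP: rD; apply/imsetP; exists s => //; rewrite -{1}rr.
  by apply/(rootP (induced_connect_sym Y)); apply: connect_trans crl cls.
rewrite -[X in (X <= _)%N](card_in_imset (f := root (induced Z))) => [|r r' rI r'I].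
  apply/subset_leq_card/subsetP => _ /imsetP[r rI ->].
  have sr := same r rI; move: (rI); rewrite !inE => /and3P[_ rY /andP[_ odr]].
  have rZ : r \in Z by rewrite inE rY.
  rewrite -in_setU (induced_connect_in rZ) ?connect_root //= root_root ?eqxx /=;
    last exact: induced_connect_sym.
  by rewrite -(@comp_eq Z r) ?connect_root // sr.
move/(rootP (induced_connect_sym Z)) => crr'.
have : r' \in comp Z r by rewrite inE.
rewrite same // inE => /(rootP (induced_connect_sym Y)).
by move: rI r'I; rewrite !inE => /and3P[_ _ /andP[/eqP-> _]] /and3P[_ _ /andP[/eqP-> _]].
Qed.

(** A matching is an involutive permutation of all of [V] whose moved points travel along edges
    inside [X]. Unmatched vertices, and all vertices outside [X], are its fixed points. *)
Definition matching X M : bool :=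
  [forall x, (M (M x) == x) && ((M x == x) || induced X x (M x))].
Definition exposed X M : {set V} := [set x in X | M x == x].
Definition max_matching X M : bool :=
  matching X M && [forall N, matching X N ==> (#|exposed X M| <= #|exposed X N|)%N].

Lemma matchingP X M : reflect (involutive M /\
  forall x, M x != x -> induced X x (M x)) (matching X M).
Proof.
apply: (iffP forallP) => [h|[h1 h2] x].
  by split=> x; have /andP[/eqP h1 h2] := h x => // /negPf nx; rewrite nx in h2.
by rewrite h1 eqxx /=; case: eqP => //= /eqP/h2.
Qed.

Lemma matching_in X M x : matching X M -> x \in X -> M x \in X.
Proof.
move=> /matchingP[_ h] xX; have [->//|/h/and3P[]//] := eqVneq (M x) x.
Qed.

Lemma max_matchingP X M : reflect (matching X M /\
  forall N, matching X N -> (#|exposed X M| <= #|exposed X N|)%N) (max_matching X M).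
Proof.
apply: (iffP andP) => -[mM h]; split=> //.
  by move=> N; apply/implyP; move/forallP: h.
by apply/forallP=> N; apply/implyP/h.
Qed.

Lemma max_matching_exists X : exists M, max_matching X M.
Proof.
have m1 : matching X 1 by apply/matchingP; split=> x; rewrite !perm1 // eqxx.
have [M mM h] := arg_minnP (fun M => #|exposed X M|) m1.
by exists M; apply/max_matchingP.
Qed.

(* Exchanging [M] and [N] on a common invariant set [P] keeps the total number
   of exposed vertices, so maximality is preserved. *)
Lemma max_matching_swap X M N (P : {set V}) :
  max_matching X M -> max_matching X N ->
  (forall x, (M x \in P) = (x \in P)) -> (forall x, (N x \in P) = (x \in P)) ->
  exists2 M', max_matching X M' & forall x, M' x = if x \in P then N x else M x.
Proof.
move=> /max_matchingP[mM hM] /max_matchingP[mN hN] MP NP.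
have [iM gM] := matchingP _ _ mM; have [iN gN] := matchingP _ _ mN.
pose sw (f g : {perm V}) x := if x \in P then g x else f x.
have inv (f g : {perm V}) : involutive f -> involutive g ->
    (forall x, (f x \in P) = (x \in P)) -> (forall x, (g x \in P) = (x \in P)) ->
    involutive (sw f g).
  move=> fi gi fP gP x; rewrite /sw; case: (boolP (x \in P)) => xP.
    by rewrite gP xP gi.
  by rewrite fP (negPf xP) fi.
pose M' := perm (inv_inj (inv M N iM iN MP NP)).
pose N' := perm (inv_inj (inv N M iN iM NP MP)).
have mM' : matching X M'.
  apply/matchingP; split=> x; rewrite !permE ?inv //.
  by rewrite /sw; case: ifP => _; [apply: gN | apply: gM].
have mN' : matching X N'.
  apply/matchingP; split=> x; rewrite !permE ?inv //.
  by rewrite /sw; case: ifP => _; [apply: gM | apply: gN].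
exists M'; last by move=> x; rewrite permE.
apply/max_matchingP; split=> // K mK; apply: leq_trans (hM K mK).
have := hN N' mN'.
have split_exp (K1 : {perm V}) : #|exposed X K1| =
   (#|exposed X K1 :&: P| + #|exposed X K1 :\: P|)%N by rewrite cardsID.
rewrite (split_exp M) (split_exp N) (split_exp M') (split_exp N').
have -> : exposed X M' :&: P = exposed X N :&: P.
  by apply/setP=> x; rewrite !inE permE /sw; case: (x \in P); rewrite ?andbF.
have -> : exposed X M' :\: P = exposed X M :\: P.
  by apply/setP=> x; rewrite !inE permE /sw; case: (x \in P).
have -> : exposed X N' :&: P = exposed X M :&: P.
  by apply/setP=> x; rewrite !inE permE /sw; case: (x \in P); rewrite ?andbF.
have -> : exposed X N' :\: P = exposed X N :\: P.
  by apply/setP=> x; rewrite !inE permE /sw; case: (x \in P).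
by rewrite leq_add2r => ?; rewrite leq_add2r.
Qed.

Lemma odd_exposed X M : matching X M -> odd #|exposed X M| = odd #|X|.
Proof.
move=> mM; have [iM _] := matchingP _ _ mM.
by rewrite [RHS](odd_card_involution iM) // => x; apply: matching_in.
Qed.

(** Otherwise the edge from [x] to [y] could be added to the matching, giving [tperm x y * M] with
    fewer exposed vertices. *)
Lemma max_matching_exposed_not_adj X M x y : max_matching X M ->
  x \in exposed X M -> y \in exposed X M -> e x y -> x = y.
Proof.
move=> /max_matchingP[mM hM]; rewrite !inE => /andP[xX /eqP Mx] /andP[yX /eqP My] exy.
apply/eqP/negPn/negP => nxy.
have [iM gM] := matchingP _ _ mM.
have dM z : z != x -> z != y -> (M z != x) * (M z != y).
  by move=> zx zy; rewrite -{1}Mx -{1}My !(inj_eq perm_inj).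
have m' : matching X (tperm x y * M)%g.
  apply/matchingP; split=> z; rewrite !permM.
    by case: (tpermP x y z) => [->|->|/eqP zx /eqP zy];
      rewrite ?Mx ?My ?tpermL ?tpermR ?Mx ?My // tpermD ?iM // eq_sym dM.
  case: (tpermP x y z) => [->|->|_ _]; last exact: gM.
    by rewrite My /induced xX yX.
  by rewrite Mx /induced xX yX e_sym.
have := hM _ m'; apply/negP; rewrite -ltnNge; apply/proper_card/properP; split.
  apply/subsetP => z; rewrite !inE permM => /andP[-> /=].
  by case: (tpermP x y z) => [->|->|_ _ ->] //; rewrite ?Mx ?My // eq_sym ?(negPf nxy).
exists x; rewrite !inE xX ?Mx //= permM tpermL My eq_sym; exact: nxy.
Qed.

(* [P] is the orbit of [v] under [s = M * N]; both involutions act on it as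
   reflections. If [M] fixes [s^i v] and [s^j v], then [s^(2i+1)] and [s^(2j+1)]
   fix [v], and i + j(2i+1) = j + i(2j+1) identifies the two points. *)
Lemma swap_orbit M N v : involutive M -> involutive N -> N v = v ->
  exists P : {set V}, [/\ v \in P, forall x, (M x \in P) = (x \in P),
    forall x, (N x \in P) = (x \in P) &
    {in P &, forall x y, M x = x -> M y = y -> x = y}].
Proof.
move=> iM iN Nv; pose s := (M * N)%g.
have MM : (M * M = 1)%g by apply/permP => x; rewrite permM perm1 iM.
have NN : (N * N = 1)%g by apply/permP => x; rewrite permM perm1 iN.
have sV : (s^-1 = N * M)%g.
  by apply/eqP; rewrite eq_invg_mul /s mulgA -(mulgA M) NN mulg1 MM.
have MV : (M^-1 = M)%g by apply/eqP; rewrite eq_invg_mul MM.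
have NV : (N^-1 = N)%g by apply/eqP; rewrite eq_invg_mul NN.
(* Conjugation by [N] or by [M] inverts [s]. As [N] fixes [v] while [M] sends it to [s^-1 v], the
   reflection by [M] shifts the exponent by one more. *)
have sN k : N ((s ^+ k)%g v) = (s ^- k)%g v.
  have sJ : (s ^ N = s^-1)%g by rewrite sV conjgE NV /s -mulgA NN mulg1.
  by rewrite -[N _]permM conjgC conjXg sJ permM Nv expgVn.
have sM k : M ((s ^+ k)%g v) = (s ^- k.+1)%g v.
  have sJ : (s ^ M = s^-1)%g by rewrite sV conjgE MV /s mulgA mulgA MM mul1g.
  have Mv : M v = (s^-1)%g v by rewrite sV permM Nv.
  by rewrite -[M _]permM conjgC conjXg sJ permM Mv expgVn expgSr (invMg (s ^+ k)%g s) permM.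
have inP k : (s ^- k)%g v \in porbit s v.
  have /cycleP[j ->] : (s ^- k)%g \in <[s]>%g by rewrite groupV mem_cycle.
  exact: mem_porbit.
exists (porbit s v); split; first exact: porbit_id.
- have h x : x \in porbit s v -> M x \in porbit s v by case/porbitP=> k ->; rewrite sM.
  by move=> x; apply/idP/idP => /h //; rewrite iM.
- have h x : x \in porbit s v -> N x \in porbit s v by case/porbitP=> k ->; rewrite sN.
  by move=> x; apply/idP/idP => /h //; rewrite iN.
have fixM k : M ((s ^+ k)%g v) = (s ^+ k)%g v -> forall l, (s ^+ (k.*2.+1 * l))%g v = v.
  rewrite sM => h l; have h1 : (s ^+ k.*2.+1)%g v = v.
    by rewrite -addnn -addnS expgD permM -h -permM mulVg perm1.
  elim: l => [|l IH]; first by rewrite muln0 expg0 perm1.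
  by rewrite mulnS expgD permM h1.
move=> _ _ /porbitP[i ->] /porbitP[j ->] /fixM hi /fixM hj.
rewrite -{1}(hi j) -{2}(hj i) -!permM -!expgD.
by congr ((s ^+ _)%g v); lia.
Qed.

(** Induction on a path from [u] to [w] with second vertex [v]. Let [N] be a maximum matching that
    misses [v], and exchange [M] for [N] on the orbit [P] of [v]. Since [P] contains at most one
    vertex fixed by [M], the new maximum matching misses [v] together with [u] or [w]: the first is
    impossible by adjacency, the second by induction. *)
Lemma gallai X :
  (forall v, v \in X -> exists2 N, max_matching X N & N v = v) ->
  forall M, max_matching X M -> {in exposed X M &, forall u w,
    connect (induced X) u w -> u = w}.
Proof.
move=> hX M mM u w uM wM /connectP[p]; elim: p u M mM uM wM => [|v p IH] u M mM uM wM //=.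
case/andP=> /and3P[uX vX euv] pv lw.
apply/eqP/negPn/negP => nuw.
have nvw : v != w.
  apply: contraNneq nuw => vw; apply/eqP.
  by apply: max_matching_exposed_not_adj mM uM wM _; rewrite -vw.
have IHv K : max_matching X K -> K v = v -> K w != w.
  move=> mK Kv; apply: contraNneq nvw => Kw; apply/eqP.
  by apply: (IH v K) => //; rewrite inE ?vX ?Kv ?Kw ?eqxx //; move: wM; rewrite inE => /andP[->].
(* [e] may have loops, so [u = v] has to be excluded as well; there the induction hypothesis applies
   to [M] itself. *)
have adjv K : max_matching X K -> K v = v -> K u != u.
  move=> mK Kv; apply/negP => Ku.
  have uv : u = v.
    by apply: max_matching_exposed_not_adj mK _ _ euv; rewrite inE ?uX ?vX ?Kv ?eqxx.
  have := IHv M mM; rewrite -uv; move: uM wM; rewrite !inE => /andP[_ /eqP->] /andP[_ ->].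
  by move/(_ erefl).
have [N mN Nv] := hX v vX.
have /max_matchingP[/matchingP[iM _] _] := mM.
have /max_matchingP[/matchingP[iN _] _] := mN.
have [P [vP MP NP uP]] := swap_orbit iM iN Nv.
have [M' mM' M'E] := max_matching_swap mM mN MP NP.
have M'v : M' v = v by rewrite M'E vP.
move: uM wM; rewrite !inE => /andP[_ /eqP Mu] /andP[_ /eqP Mw].
have [uinP|uP'] := boolP (u \in P); last first.
  by have := adjv _ mM' M'v; rewrite M'E (negPf uP') Mu eqxx.
have [winP|wP'] := boolP (w \in P); last first.
  by have := IHv _ mM' M'v; rewrite M'E (negPf wP') Mw eqxx.
by case/eqP: nuw; apply: uP.
Qed.

(** Induction on the size of [X]: a vertex covered by every maximum matching is moved into the
    barrier; if there is none, [gallai] shows that the empty barrier works. *)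
Theorem tutte_berge X M : max_matching X M ->
  exists2 A : {set V}, A \subset X & (#|A| + #|exposed X M| <= oddc (X :\: A))%N.
Proof.
have [n] := ubnP #|X|; elim: n X M => // n IH X M ltX mM.
have [/existsP[v /andP[vX /forallP hv]]|hX] := boolP
  [exists v, (v \in X) && [forall N, max_matching X N ==> (N v != v)]].
  have [N mN] := max_matching_exists (X :\ v).
  have [|A sA leA] := IH (X :\ v) N _ mN.
    by move: ltX; rewrite [in #|X|](cardsD1 v) vX.
  have /max_matchingP[mN' _] := mN; have [iN gN] := matchingP _ _ mN'.
  have Nv : N v = v.
    by apply/eqP/negPn/negP => /gN; rewrite /induced !inE eqxx.
  have mNX : matching X N.
    apply/matchingP; split=> // x /gN; rewrite /induced !inE.
    by case/and3P=> /andP[_ ->] /andP[_ ->] ->.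
  have cN : #|exposed X N| = #|exposed (X :\ v) N|.+1.
    rewrite (cardsD1 v) inE vX Nv eqxx; congr _.+1.
    by apply: eq_card => x; rewrite !inE andbA.
  have /max_matchingP[mM' hM] := mM.
  have lt : (#|exposed X M| < #|exposed X N|)%N.
    rewrite ltnNge; apply/negP => le.
    have := hv N; rewrite Nv eqxx implybF => /negP; apply; apply/max_matchingP.
    by split=> // K mK; apply: leq_trans le (hM K mK).
  (* Parity turns the strict inequality into a gap of 2, which pays for adding [v] to the
     barrier. *)
  have par : odd #|exposed X M| = odd #|exposed X N| by rewrite !odd_exposed.
  exists (v |: A).
    by apply/subsetP => x; rewrite !inE => /predU1P[->//|/(subsetP sA)]; rewrite inE => /andP[].
  have -> : X :\: (v |: A) = X :\ v :\: A by rewrite setDDl.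
  apply: leq_trans leA; rewrite cardsU1.
  have -> : v \notin A by apply/negP => /(subsetP sA); rewrite !inE eqxx.
  by move: lt par; rewrite cN /= => lt par; lia.
have hX' v : v \in X -> exists2 N, max_matching X N & N v = v.
  move=> vX; move: hX; rewrite negb_exists => /forallP/(_ v).
  rewrite vX negb_forall => /existsP[N]; rewrite negb_imply negbK => /andP[mN /eqP Nv].
  by exists N.
have gX := gallai hX' mM.
(* A component with an exposed vertex contains only one, and [M] pairs its other vertices, so it is
   odd. *)
exists set0; first exact: sub0set.
rewrite cards0 add0n setD0 -(card_in_imset (f := root (induced X)) (D := mem (exposed X M))).
  apply/subset_leq_card/subsetP => _ /imsetP[x xM ->].
  have xX : x \in X by move: xM; rewrite inE => /andP[].
  rewrite inE (induced_connect_in xX) ?connect_root //=.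
  rewrite root_root ?eqxx /=; last exact: induced_connect_sym.
  rewrite -(@comp_eq X x) ?connect_root //.
  have /max_matchingP[mM' _] := mM; have [iM gM] := matchingP _ _ mM'.
  rewrite (odd_card_involution iM).
    have -> : [set y in comp X x | M y == y] = [set x]; last by rewrite cards1.
    apply/setP=> y; rewrite !inE; apply/andP/eqP => [[cxy /eqP My]|->].
      apply/esym/gX => //.
      by rewrite inE My eqxx (induced_connect_in xX).
    by rewrite connect0; move: xM; rewrite inE => /andP[].
  move=> y; rewrite !inE => cxy; have [->//|/gM g] := eqVneq (M y) y.
  exact: connect_trans cxy (connect1 g).
move=> x y xM yM /(rootP (induced_connect_sym X)); exact: gX.
Qed.

(** The number of exposed vertices is positive and even, hence at least 2. *)
Corollary tutte X : (forall M, matching X M -> exists2 x, x \in X & M x = x) ->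
  ~~ odd #|X| -> exists2 A : {set V}, A \subset X & (#|A| + 2 <= oddc (X :\: A))%N.
Proof.
move=> hX evX; have [M mM] := max_matching_exists X.
have [A sA leA] := tutte_berge mM; exists A => //.
have /max_matchingP[mM' _] := mM; have [x xX Mx] := hX M mM'.
have : (0 < #|exposed X M|)%N by apply/card_gt0P; exists x; rewrite inE xX Mx eqxx.
have := odd_exposed mM'; rewrite (negPf evX).
by move: leA; lia.
Qed.

(* Removing [B] from a barrier of least cardinality must lose at least [#|B| + 2]
   odd components, by parity. *)
Lemma minimal_barrier X : ~~ odd #|X| ->
  (exists2 A : {set V}, A \subset X & (#|A| + 2 <= oddc (X :\: A))%N) ->
  exists A : {set V}, [/\ A \subset X, (#|A| + 2 <= oddc (X :\: A))%N &
    forall B R : {set V}, B \subset A -> B != set0 ->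
      (forall b y, b \in B -> y \in X -> y \notin A -> e b y ->
        exists2 r, r \in R & connect (induced (X :\: A)) y r) ->
      (#|B| + 2 <= #|R|)%N].
Proof.
move=> evX [A0 sA0 leA0].
pose bar A := (A \subset X) && (#|A| + 2 <= oddc (X :\: A))%N.
have h0 : bar A0 by rewrite /bar sA0.
have [A /andP[sA leA] minA] := arg_minnP (fun A => #|A|) h0.
exists A; split=> // B R sB nB hR.
have := @oddc_setU (X :\: A) B R.
have -> : (X :\: A) :|: B = X :\: (A :\: B).
  apply/setP=> x; rewrite !inE negb_and negbK.
  have [xB|_] := boolP (x \in B); last by rewrite orbF.
  by rewrite (subsetP sA) ?(subsetP sB) // andbT orbT.
move=> leR.
have {}leR : (oddc (X :\: A) <= oddc (X :\: (A :\: B)) + #|R|)%N.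
  by apply: leR => b y bB; rewrite inE => /andP[yA yX]; apply: hR.
have cAB : #|A| = (#|B| + #|A :\: B|)%N.
  by rewrite -(cardsID B A) (setIidPr sB).
have B0 : (0 < #|B|)%N by rewrite card_gt0.
have sAB : A :\: B \subset X by apply: subset_trans sA; apply: subsetDl.
have lt : (oddc (X :\: (A :\: B)) < #|A :\: B| + 2)%N.
  rewrite ltnNge; apply/negP => le.
  by have := minA (A :\: B); rewrite /bar sAB le => /(_ isT); rewrite cAB; lia.
have := odd_oddc (X :\: (A :\: B)).
have := cardsID (A :\: B) X; rewrite (setIidPr sAB).
by move: evX leA leR lt; rewrite cAB; lia.
Qed.
End Graph.

(** * The gadget graph *)

Section Gadget.
Variables (V : finType) (m : V -> V -> nat) (f : V -> nat) (N : nat) (b : bool).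
Hypothesis m_graph : multigraph m.
Hypothesis f_bound : forall x, (f x <= N.+1)%N.
Hypothesis m_bound : forall x y, (m x y <= N.+1)%N.
Let m_sym : forall x y, m x y = m y x := proj1 m_graph.
Let m_irr : forall x, m x x = 0%N := proj2 m_graph.

Local Notation W := (V * 'I_N.+1 + (V * V * 'I_N.+1) + unit)%type.
Local Notation copy x i := (inl (inl (x, i))).
Local Notation half x y i := (inl (inr (x, y, i))).
Local Notation apex := (inr tt : W).

(* For [i < f x], [copy x i] is a copy of the vertex [x]; for [i < m x y],
   [half x y i] is the end at [x] of the [i]-th edge between [x] and [y]. Indices
   out of these ranges are excluded by [gadget_set], which contains [apex] only if
   [b] holds. In a perfect matching the edges whose two ends are not matched to
   each other form a near [f]-factor: each [x] lies on [f x] of them, through its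
   copies, and the partner of [apex] accounts for the exceptional vertex. *)
Definition gadget : rel W := fun w w' =>
  match w, w' with
  | copy x _, half y _ _ => x == y
  | half x _ _, copy y _ => x == y
  | half x y i, half x' y' i' => [&& x == y', y == x' & i == i']
  | half _ _ _, inr _ | inr _, half _ _ _ => true
  | _, _ => false
  end.

Definition copies (P : pred V) : {set W} :=
  [set w : W | if w is copy x i then P x && (i < f x)%N else false].
Definition halves (P : rel V) : {set W} :=
  [set w : W | if w is half x y i then P x y && (i < m x y)%N else false].
Definition gadget_set : {set W} :=
  [set w : W | match w with
           | copy x i => (i < f x)%N
           | half x y i => (i < m x y)%N
           | inr _ => b
           end].

Lemma in_copies P x i : (copy x i \in copies P) = P x && (i < f x)%N.
Proof. by rewrite inE. Qed.

Lemma in_halves P x y i : (half x y i \in halves P) = P x y && (i < m x y)%N.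
Proof. by rewrite inE. Qed.

Lemma copy_in_gadget x i : (copy x i \in gadget_set) = (i < f x)%N.
Proof. by rewrite inE. Qed.

Lemma half_in_gadget x y i : (half x y i \in gadget_set) = (i < m x y)%N.
Proof. by rewrite inE. Qed.

Lemma gadget_sym : symmetric gadget.
Proof.
move=> [[[x i]|[[x y] i]]|[]] [[[x' i']|[[x' y'] i']]|[]] //=; rewrite 1?eq_sym //.
by rewrite andbCA [y == _]eq_sym [i == _]eq_sym [y' == _]eq_sym.
Qed.

Lemma sum_ord_ltn k : (k <= N.+1)%N -> (\sum_(i < N.+1) (if i < k then 1 else 0) = k)%N.
Proof.
by move=> kN; rewrite -big_mkcond -(big_ord_widen _ (fun=> 1%N) kN) sum1_card card_ord.
Qed.

Lemma sum_gadget (F : W -> nat) : (\sum_w F w =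
  \sum_x \sum_i F (copy x i) + \sum_x \sum_y \sum_i F (half x y i) + F apex)%N.
Proof.
rewrite !big_sumType /=; congr (_ + _ + _)%N.
- by rewrite pair_big; apply: eq_bigr => -[].
- by rewrite pair_big pair_big /=; apply: eq_bigr => -[[x y] i].
- by rewrite (big_pred1 tt) // => -[].
Qed.

Lemma card_copies P : (#|copies P| = \sum_(x | P x) f x)%N.
Proof.
rewrite -sum1dep_card big_mkcond sum_gadget /=.
rewrite [X in (_ + X + _)%N]big1 => [|x _]; last by rewrite big1 // => y _; rewrite big1.
rewrite !addn0 [RHS]big_mkcond; apply: eq_bigr => x _.
by case: (P x) => /=; [apply: sum_ord_ltn | rewrite big1].
Qed.

Lemma card_halves P : (#|halves P| = \sum_x \sum_(y | P x y) m x y)%N.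
Proof.
rewrite -sum1dep_card big_mkcond sum_gadget /=.
rewrite [X in (X + _ + _)%N]big1 => [|x _]; last by rewrite big1.
rewrite add0n addn0; apply: eq_bigr => x _; rewrite [RHS]big_mkcond; apply: eq_bigr => y _.
by case: (P x y) => /=; [apply: sum_ord_ltn | rewrite big1].
Qed.

Lemma card_halves_l (P : pred V) : (#|halves (fun x _ => P x)| = \sum_(x | P x) deg m x)%N.
Proof.
rewrite card_halves [RHS]big_mkcond; apply: eq_bigr => x _.
by case: (P x); rewrite ?big_pred0_eq.
Qed.

(** Exchanging the two ends of each edge is an involution on the halves, without fixed points
    because there are no loops. *)
Lemma even_sum_deg : ~~ odd (\sum_x deg m x).
Proof.
pose rev (w : W) : W := if w is half x y i then half y x i else w.
have rev_inv : involutive rev by move=> [[[x i]|[[x y] i]]|[]].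
rewrite -(card_halves_l predT) (odd_card_involution rev_inv).
  rewrite (_ : [set w in _ | _] = set0) ?cards0 //.
  apply/setP=> -[[[x i]|[[x y] i]]|[]] //; rewrite !inE //=.
  by apply/negP => /andP[h /eqP[xy _]]; move: h; rewrite xy m_irr.
by move=> [[[x i]|[[x y] i]]|[]] //; rewrite !inE //= m_sym.
Qed.

Lemma odd_gadget_set : b = odd (\sum_x f x) -> ~~ odd #|gadget_set|.
Proof.
move=> bE.
have -> : (#|gadget_set| = \sum_x f x + \sum_x deg m x + b)%N.
  rewrite -sum1dep_card big_mkcond sum_gadget; congr (_ + _ + _)%N.
    by apply: eq_bigr => x _; rewrite /= sum_ord_ltn.
  by apply: eq_bigr => x _; apply: eq_bigr => y _; rewrite /= sum_ord_ltn.
rewrite !oddD (negPf even_sum_deg) bE.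
by case: (odd _).
Qed.

Lemma near_factor_of_perfect M : matching gadget gadget_set M ->
  (forall w, w \in gadget_set -> M w != w) -> near_factor m f.
Proof.
move=> /matchingP[iM gM] pM; have {gM} gM w (wX : w \in gadget_set) := gM w (pM w wX).
pose F x y := (\sum_(i < N.+1) ((i < m x y) && (M (half x y i) != half y x i)))%N.
(* A half at [x] not matched to its other end is matched to a copy of [x] or to [apex]. Every copy
   of [x] is matched to such a half, which accounts for the term [f x]. *)
have degF x : deg F x = (f x + #|[set w in halves (fun a _ => a == x) | M w == apex]|)%N.
  have -> : deg F x =
      #|[set w in halves (fun a _ => a == x) | ~~ (if M w is half _ _ _ then true else false)]|.
    rewrite -sum1dep_card big_mkcond sum_gadget /= [X in (_ = X + _ + _)%N]big1 => [|a _];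
      last by rewrite big1 // => i _; rewrite inE.
    rewrite [in RHS]inE /= add0n addn0 (bigD1 x) //= [X in (_ = _ + X)%N]big1 => [|a nax];
      last by rewrite big1 // => y _; rewrite big1 // => i _; rewrite inE (negPf nax).
    rewrite addn0; apply: eq_bigr => y _; apply: eq_bigr => i _; rewrite inE eqxx /=.
    case: ltnP => //= im; have hX : half x y i \in gadget_set by rewrite inE.
    have /and3P[_ _] := gM _ hX.
    case: (M _) => [[[x' i']|[[x' y'] i']]|[]] //=.
    by case/and3P=> /eqP<- /eqP<- /eqP<-; rewrite eqxx.
  have <- : #|M @: copies (pred1 x)| = f x.
    by rewrite card_imset ?card_copies ?big_pred1_eq //; apply: perm_inj.
  rewrite -[LHS](cardsID [set w : W | M w == apex]) addnC; congr (_ + _)%N; apply: eq_card => w.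
    rewrite -[in RHS](iM w) mem_imset; last exact: perm_inj.
    apply/idP/idP.
      case: w => [[[a i]|[[a y] i]]|[]]; rewrite !inE ?andbF //=.
      move=> /and3P[nap /andP[/eqP ax im] nh]; subst a.
      have hX : half x y i \in gadget_set by rewrite inE.
      have /and3P[_] := gM _ hX; move: nap nh.
      case: (M _) => [[[x' i']|[[x' y'] i']]|[]] //=; rewrite inE => _ _ -> /eqP->.
      by rewrite /= eqxx.
    move=> MC; have MX : M w \in gadget_set.
      by move: MC; case: (M w) => [[[x' i']|[[x' y'] i']]|[]]; rewrite !inE // => /andP[].
    have /and3P[_] := gM _ MX; rewrite iM; move: MC; rewrite !inE.
    case: (M w) => [[[x' i']|[[x' y'] i']]|[]] //= /andP[/eqP-> _].
    by case: w {MX} => [[[a i]|[[a y] i]]|[]] //= im /eqP->; rewrite eqxx im.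
  rewrite !inE; case: (M w == apex) / eqP => [->|_]; last by rewrite !andbF.
  by rewrite !andbT.
exists F; split.
  split; last first.
    move=> x y; rewrite -[leqRHS](sum_ord_ltn (m_bound x y)); apply: leq_sum => i _.
    by case: (i < _)%N => //=; case: (_ != _).
  split=> [x y|x]; last by rewrite /F big1 // => i _; rewrite m_irr.
  apply: eq_bigr => i _; rewrite m_sym; congr (nat_of_bool (_ && ~~ _)).
  by apply/eqP/eqP => <-; rewrite iM.
have [b1|b0] := boolP b; [right|left]; last first.
  move=> x; rewrite degF; rewrite (_ : [set w in _ | _] = set0) ?cards0 ?addn0 //.
  apply/setP => w; rewrite !inE; apply/negP => /andP[wh /eqP Mw].
  have wX : w \in gadget_set.
    by move: wh; case: w {Mw} => [[[a i]|[[a y] i]]|[]] //; rewrite !inE => /andP[].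
  by have /and3P[_] := gM _ wX; rewrite Mw inE (negPf b0).
have aX : apex \in gadget_set by rewrite inE.
have := gM _ aX; case Ma : (M apex) => [[[u i]|[[u y] i]]|[]] /and3P[_ hX //= _].
have Mh : M (half u y i) = apex by rewrite -Ma iM.
have eqh w : (M w == apex) = (w == half u y i).
  by rewrite -{1}Mh (inj_eq perm_inj).
exists u; split=> [|v nvu]; rewrite degF.
  rewrite (_ : [set w in _ | _] = [set half u y i]) ?cards1 ?addn1 //.
  apply/setP=> w; rewrite !inE eqh; case: eqP => [->|]; rewrite ?andbF //= eqxx andbT.
  by move: hX; rewrite inE.
rewrite (_ : [set w in _ | _] = set0) ?cards0 ?addn0 //.
apply/setP=> w; rewrite !inE eqh; case: eqP => [->|]; rewrite ?andbF //= andbT.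
by rewrite eq_sym (negPf nvu).
Qed.

Hypothesis f_gt0 : forall x, (0 < f x)%N.
Hypothesis f_deg : forall x, (f x <= deg m x)%N.

(** * Structure of a barrier of least cardinality in the gadget *)

Section MinimalBarrier.
Variable A : {set W}.
Hypothesis A_sub : A \subset gadget_set.
Hypothesis A_barrier : (#|A| + 2 <= oddc gadget (gadget_set :\: A))%N.
Hypothesis A_min : forall B R : {set W}, B \subset A -> B != set0 ->
  (forall b y, b \in B -> y \in gadget_set -> y \notin A -> gadget b y ->
     exists2 r, r \in R & connect (induced gadget (gadget_set :\: A)) y r) ->
  (#|B| + 2 <= #|R|)%N.

Local Notation Y := (gadget_set :\: A).
Local Notation conn := (connect (induced gadget Y)).

Let conn_sym : connect_sym (induced gadget Y).
Proof. exact/induced_connect_sym/gadget_sym. Qed.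

(** One copy is enough to test: by [copy_in] the barrier contains all copies of [x] or none.
    Likewise [half_in] shows that it contains no half at a vertex outside [T]. *)
Let S : {set V} := [set x | copy x ord0 \in A].
Let T : {set V} := [set x | halves (fun a _ => a == x) \subset A].

(** Ensures that the inclusion defining [T] is never vacuous. *)
Lemma half_exists x : exists y i, half x y i \in halves (fun a _ => a == x).
Proof.
have : (0 < deg m x)%N := leq_trans (f_gt0 x) (f_deg x).
rewrite -[deg m x](big_pred1_eq addn x) -card_halves_l => /card_gt0P[w].
case: w => [[[a i]|[[a y] i]]|[]]; rewrite inE // => /andP[/eqP-> h].
by exists y, i; rewrite inE eqxx.
Qed.

Lemma half_notin x : x \notin T -> exists y i, half x y i \in Y.
Proof.
rewrite inE => /subsetPn[w].
case: w => [[[a i]|[[a y] i]]|[]]; rewrite inE // => /andP[/eqP-> h] nA.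
by exists y, i; rewrite !inE nA.
Qed.

Lemma conn_edge w w' : w \in Y -> w' \in Y -> gadget w w' -> conn w w'.
Proof. by move=> h h' g; apply: connect1; rewrite /induced h h'. Qed.

Lemma sum_deg_le_card : (\sum_(x in T) deg m x <= #|A|)%N.
Proof.
rewrite -card_halves_l; apply/subset_leq_card/subsetP => w.
case: w => [[[a i]|[[a y] i]]|[]]; rewrite inE // => /andP[aT h].
by move: aT; rewrite inE => /subsetP; apply; rewrite inE eqxx.
Qed.

(** If [apex] stayed, everything but the copies of vertices of [T] would lie in its component. There
    would be at most f(T) + 1 odd components, but f(T) is at most the degree sum of [T], hence at
    most [#|A|]. *)
Lemma apex_in : b -> apex \in A.
Proof.
move=> b1; apply/negPn/negP => zA.
have zY : apex \in Y by rewrite in_setD zA inE.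
have : (oddc gadget Y <= #|copies (fun x => x \in T) :|: [set apex]|)%N.
  apply: oddc_leq_card => [|w wY _]; first exact: gadget_sym.
  have half_z x y i : half x y i \in Y -> conn (half x y i) apex.
    by move=> hY; apply: conn_edge.
  case: w wY => [[[x i]|[[x y] i]]|[]] wY; last 1 first.
  - by exists apex; rewrite ?connect0 // in_setU set11 orbT.
  - have [xT|xT] := boolP (x \in T).
      exists (copy x i); rewrite ?connect0 // in_setU in_copies xT.
      by move: wY; rewrite in_setD copy_in_gadget => /andP[_ ->].
    have [y [j hY]] := half_notin xT; exists apex; first by rewrite in_setU set11 orbT.
    by apply: connect_trans (half_z _ _ _ hY); apply: conn_edge => //=.
  - by exists apex; rewrite ?half_z // in_setU set11 orbT.
move=> le; have := leq_trans A_barrier le; have := sum_deg_le_card.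
have := cardsU (copies (fun x => x \in T)) [set apex].
rewrite cards1 card_copies.
have : (\sum_(x in T) f x <= \sum_(x in T) deg m x)%N by apply: leq_sum.
by lia.
Qed.

Lemma apex_notin : apex \notin Y.
Proof.
rewrite in_setD inE; have [/apex_in->//|] := boolP b; by rewrite andbF.
Qed.

(** Copies of [x] have the same neighbours. Putting one back beside a remaining copy touches a
    single component, where minimality demands three. *)
Lemma copy_in x i : copy x i \in gadget_set -> (copy x i \in A) = (x \in S).
Proof.
have key j k : copy x j \in A -> copy x k \in gadget_set -> copy x k \in A.
  move=> jA kX; apply/negPn/negP => kA.
  have kY : copy x k \in Y by rewrite inE kA kX.
  have := A_min (B := [set copy x j]) (R := [set copy x k]).
  rewrite sub1set jA -card_gt0 !cards1 => /(_ isT isT) h; suff: (1 + 2 <= 1)%N by [].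
  apply: h => _ w /set1P-> wX wA jw; exists (copy x k); first exact: set11.
  apply: conn_edge => //; first by rewrite inE wA wX.
  by case: w jw {wX wA} => [[[a i']|[[a y] i']]|[]] //=; rewrite eq_sym.
move=> iX; rewrite inE; apply/idP/idP => h; last exact: key h iX.
by apply: key h _; rewrite inE f_gt0.
Qed.

(** With all copies of [x] in the barrier, the only possible neighbour outside it is the opposite
    half, so putting the half back touches at most one component. *)
Lemma half_in_S x y i : half x y i \in A -> x \notin S.
Proof.
move=> hA; apply/negP => xS.
have hX := subsetP A_sub _ hA.
have := A_min (B := [set half x y i]) (R := [set half y x i]).
rewrite sub1set hA -card_gt0 !cards1 => /(_ isT isT) h; suff: (1 + 2 <= 1)%N by [].
apply: h => _ w /set1P-> wX wA hw.
case: w hw wX wA => [[[a i']|[[a y'] i']]|[]] //=.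
- by move=> /eqP<- wX; rewrite copy_in // xS.
- by case/and3P=> /eqP<- /eqP<- /eqP<- _ _; exists (half y x i); rewrite ?set11 ?connect0.
by move=> _; rewrite inE => /apex_in->.
Qed.

(** If another half at [x] remains, it joins all copies of [x] into one component. Putting
    [half x y i] back then touches at most that component and the one of the opposite half, fewer
    than the three required. *)
Lemma half_in x y i : half x y i \in gadget_set -> (half x y i \in A) = (x \in T).
Proof.
move=> hX; apply/idP/idP => [hA|]; last first.
  by rewrite inE => /subsetP; apply; move: hX; rewrite !inE eqxx.
apply/negPn/negP => /half_notin[y' [i' hY]].
have xS := half_in_S hA.
have cY : copy x ord0 \in Y.
  have cX : copy x ord0 \in gadget_set by rewrite inE f_gt0.
  by rewrite in_setD cX copy_in // xS.
have := A_min (B := [set half x y i]) (R := [set half y x i; copy x ord0]).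
rewrite sub1set hA -card_gt0 cards1 cards2 => /(_ isT isT) h; suff: (1 + 2 <= 2)%N by [].
apply: h => _ w /set1P-> wX wA hw.
have wY : w \in Y by rewrite in_setD wA.
case: w hw wX wA wY => [[[a j]|[[a b'] j]]|[]] //=.
- move=> /eqP<- wX wA wY; exists (copy x ord0); first by rewrite !inE eqxx orbT.
  apply: (@connect_trans _ _ (half x y' i')); apply: conn_edge => //=.
- by case/and3P=> /eqP<- /eqP<- /eqP<- _ _ _; exists (half y x i); rewrite ?connect0 // !inE eqxx.
by move=> _ _ _; rewrite (negPf apex_notin).
Qed.

Lemma disjoint_ST x : x \in T -> x \notin S.
Proof.
move=> xT; have [y [i h]] := half_exists x; apply: (@half_in_S x y i).
by move: xT; rewrite inE => /subsetP; apply.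
Qed.

(** Minimality is applied to all halves at [x] together: outside the barrier they are adjacent only
    to copies of [x] and to opposite halves at vertices outside [T]. The edges leaving [T]
    cancel. *)
Lemma degree_in_T x : x \in T -> (\sum_(y in T) m x y + 2 <= f x)%N.
Proof.
move=> xT; pose B := halves (fun a _ => a == x).
have BA : B \subset A by move: xT; rewrite inE.
have := A_min (B := B) (R := copies (pred1 x) :|: halves (fun a y => (y == x) && (a \notin T))).
have [y [i h]] := half_exists x.
have nB : B != set0 by apply/set0Pn; exists (half x y i).
move=> /(_ BA nB) le.
have {le}/le : forall w w', w \in B -> w' \in gadget_set -> w' \notin A -> gadget w w' ->
  exists2 r, r \in copies (pred1 x) :|: halves (fun a y => (y == x) && (a \notin T)) & conn w' r.
  move=> w w' wB wX wA g; exists w'; last exact: connect0.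
  rewrite inE; case: w wB g => [[[a j]|[[a c] j]]|[]]; rewrite inE // => /andP[/eqP-> _].
  case: w' wX wA => [[[a' j']|[[a' c'] j']]|[]] //=.
  - by rewrite !inE => -> _ /eqP->; rewrite eqxx.
  - move=> wX wA /and3P[/eqP xc _ _]; subst c'; apply/orP; right.
    by rewrite in_halves eqxx -(half_in wX) wA -half_in_gadget wX.
  by rewrite inE => /apex_in->.
rewrite (card_halves_l (pred1 x)) big_pred1_eq => le.
have {le} := leq_trans le (leq_card_setU _ _).
rewrite card_copies big_pred1_eq card_halves.
have -> : (\sum_a \sum_(y0 | (y0 == x) && (a \notin T)) m a y0 = \sum_(a | a \notin T) m x a)%N.
  rewrite [RHS]big_mkcond; apply: eq_bigr => a _.
  case: (a \notin T); last by rewrite big_pred0 // => y0; rewrite andbF.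
  by rewrite (big_pred1 x) 1?m_sym // => y0; rewrite andbT.
rewrite /deg (bigID (mem T)) /=; lia.
Qed.

(** Each edge of the path lifts to a walk copy, half, half, copy in the gadget. *)
Lemma copy_root x y : x \notin S :|: T -> connect (adj_del m (S :|: T)) x y ->
  conn (copy x ord0) (copy y ord0).
Proof.
have cY z : z \notin S :|: T -> copy z ord0 \in Y.
  rewrite inE negb_or => /andP[zS _].
  have cX : copy z ord0 \in gadget_set by rewrite inE f_gt0.
  by rewrite in_setD cX copy_in // zS.
have hY z w (j : 'I_N.+1) : z \notin S :|: T -> (j < m z w)%N -> half z w j \in Y.
  rewrite inE negb_or => /andP[_ zT] jm.
  have hX : half z w j \in gadget_set by rewrite inE.
  by rewrite in_setD hX half_in // zT.
move=> xST /connectP[p pp ->]; elim: p x xST pp => [|z p IH] x xST /=; first by rewrite connect0.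
case/andP=> /and3P[_ zST m0] pz; apply: connect_trans (IH _ zST pz).
have h1 := hY x z ord0 xST m0.
have h2 := hY z x ord0 zST (etrans (congr1 (leq 1) (m_sym z x)) m0).
apply: (@connect_trans _ _ (half x z ord0)); first by apply: conn_edge; rewrite ?cY /=.
apply: (@connect_trans _ _ (half z x ord0)); first by apply: conn_edge; rewrite //= !eqxx.
by apply: conn_edge; rewrite ?cY /=.
Qed.

Lemma barrier_count : (\sum_(x in S) f x + \sum_(x in T) \sum_(y | y \notin S) m x y + 2
  <= \sum_(x in T) f x + ncomp_del m (S :|: T))%N.
Proof.
have adj_sym : connect_sym (adj_del m (S :|: T)).
  by apply: sym_connect_sym => x y; rewrite /adj_del andbCA m_sym.
have leA : (\sum_(x in S) f x + \sum_(x in T) deg m x <= #|A|)%N.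
  rewrite -card_copies -card_halves_l -cardsUI.
  rewrite [X in (_ + #|pred_of_set X|)%N](_ : _ = set0) ?cards0 ?addn0; last first.
    by apply/setP => -[[[x i]|[[x y] i]]|[]]; rewrite !inE ?andbF.
  apply/subset_leq_card/subsetP => w.
  case: w => [[[x i]|[[x y] i]]|[]]; rewrite in_setU !in_set ?orbF //= => /andP[xS h].
    by rewrite copy_in ?inE //; move: xS; rewrite inE.
  by move: xS => /subsetP; apply; rewrite inE eqxx.
(* Representatives of the odd components: one copy for each component of the graph without [S] and
   [T], and in [R1] the isolated vertices, namely copies of vertices of [T] and halves at [S]
   towards [T]. *)
pose R0 : {set W} := [set copy r ord0 |
  r in predI (roots (adj_del m (S :|: T))) (mem (~: (S :|: T)))].
pose R1 := copies (fun x => x \in T) :|: halves (fun x y => (x \in S) && (y \in T)).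
have cR : (#|R1 :|: R0| <= \sum_(x in T) f x + \sum_(x in S) \sum_(y in T) m x y
   + ncomp_del m (S :|: T))%N.
  apply: leq_trans (leq_card_setU _ _) _; rewrite leq_add ?leq_imset_card //.
  apply: leq_trans (leq_card_setU _ _) _; rewrite card_copies card_halves leq_add2l.
  rewrite [leqRHS]big_mkcond /=; apply: leq_sum => x _.
  by case: (x \in S); rewrite ?big_pred0_eq.
have hR0 x : x \notin S :|: T -> exists2 r, r \in R1 :|: R0 & conn (copy x ord0) r.
  move=> xST; exists (copy (root (adj_del m (S :|: T)) x) ord0); last first.
    exact/copy_root/connect_root.
  have cl : closed (adj_del m (S :|: T)) (~: (S :|: T)).
    by apply: intro_closed => // u v /and3P[_ vST _] _; rewrite in_setC.
  rewrite in_setU; apply/orP; right; apply: imset_f; apply/andP; split; first exact: roots_root.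
  by rewrite /= -(closed_connect cl (connect_root _ _)) in_setC.
have hR w : w \in Y -> odd #|comp gadget Y w| ->
    exists2 r, r \in R1 :|: R0 & conn w r.
  have halfY x y i : half x y i \in Y -> (i < m x y)%N * (x \notin T).
    by rewrite in_setD => /andP[hA hX]; rewrite -(half_in hX) hA -half_in_gadget.
  have toY x y (i : 'I_N.+1) : (i < m x y)%N -> x \notin T -> half x y i \in Y.
    move=> hX hT; have hX' : half x y i \in gadget_set by rewrite half_in_gadget.
    by rewrite in_setD hX' half_in // hT.
  have copyY x (i : 'I_N.+1) : (i < f x)%N -> x \notin S -> copy x i \in Y.
    move=> hX hS; have hX' : copy x i \in gadget_set by rewrite copy_in_gadget.
    by rewrite in_setD hX' copy_in // hS.
  have hhalf x y i : half x y i \in Y -> x \notin S ->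
      exists2 r, r \in R1 :|: R0 & conn (half x y i) r.
    move=> hY xS; have [_ xT] := halfY _ _ _ hY.
    have [|r rR cr] := hR0 x; first by rewrite in_setU negb_or xS.
    exists r => //; apply: connect_trans cr; apply: conn_edge => //=.
    exact: copyY.
  case: w => [[[x i]|[[x y] i]]|[]] wY; last by rewrite (negPf apex_notin) in wY.
    move: (wY); rewrite in_setD copy_in_gadget => /andP[cA cX].
    have xS : x \notin S by rewrite -(@copy_in x i) ?copy_in_gadget.
    have [xT _|xT _] := boolP (x \in T).
      by exists (copy x i); rewrite ?connect0 // !in_setU in_copies xT cX.
    have [y [j hY]] := half_notin xT; have [r rR cr] := hhalf x y j hY xS.
    by exists r => //; apply: connect_trans cr; apply: conn_edge => /=.
  have [xS|xS _] := boolP (x \in S); last exact: hhalf.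
  have [im xT] := halfY _ _ _ wY.
  have [yT _|yT] := boolP (y \in T).
    by exists (half x y i); rewrite ?connect0 // !in_setU in_halves xS yT im orbT.
  have revY : half y x i \in Y by apply: toY; rewrite // m_sym.
  have [yS|yS _] := boolP (y \in S); last first.
    have [r rR cr] := hhalf y x i revY yS; exists r => //.
    by apply: connect_trans cr; apply: conn_edge => //=; rewrite !eqxx.
  (* An edge inside [S] leaves a component consisting of its two halves, which is even. *)
  have -> : comp gadget Y (half x y i) = [set half x y i; half y x i]; last first.
    rewrite cards2; case: eqP => // -[xy _]; by move: im; rewrite xy m_irr.
  apply/setP=> w; rewrite in_set; apply/idP/idP => [cw|]; last first.
    case/set2P=> ->; first exact: connect0.
    by apply: conn_edge => //=; rewrite !eqxx.
  have cl : closed (induced gadget Y) [set half x y i; half y x i].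
    have step c d v : c \in S -> v \in Y -> gadget (half c d i) v -> v = half d c i.
      case: v => [[[a j]|[[a a'] j]]|[]] cS vY //=.
      - move=> /eqP ca; move: vY; rewrite in_setD -ca => /andP[cA cX].
        by move: cA; rewrite copy_in // cS.
      - by case/and3P=> /eqP<- /eqP<- /eqP<-.
      by move: vY; rewrite (negPf apex_notin).
    apply: (intro_closed conn_sym) => u v /and3P[_ vY uv] uE.
    by case/set2P: uE uv => -> /step ->; rewrite ?set21 ?set22.
  by rewrite -(closed_connect cl cw) set21.
have le := leq_trans A_barrier (leq_trans (oddc_leq_card gadget_sym hR) cR).
(* The edges between [S] and [T] occur both in the size of the barrier and among the
   representatives, so they cancel. *)
have degT : (\sum_(x in T) deg m x = \sum_(x in S) \sum_(y in T) m x y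
    + \sum_(x in T) \sum_(y | y \notin S) m x y)%N.
  rewrite [X in (_ = X + _)%N]exchange_big -big_split; apply: eq_bigr => x xT /=.
  rewrite /deg (bigID (mem S)) /=; congr (_ + _)%N.
  by apply: eq_bigr => y _; apply: m_sym.
by move: leA; rewrite degT; lia.
Qed.
End MinimalBarrier.
End Gadget.

Lemma near_factor_or_barrier (V : finType) (m : V -> V -> nat) (f : V -> nat) :
  multigraph m -> (forall x, (0 < f x)%N) -> (forall x, (f x <= deg m x)%N) ->
  near_factor m f \/ exists S T : {set V}, [/\ {in T, forall x, x \notin S},
    (\sum_(x in S) f x + \sum_(x in T) \sum_(y | y \notin S) m x y + 2
       <= \sum_(x in T) f x + ncomp_del m (S :|: T))%N &
    {in T, forall x, (\sum_(y in T) m x y + 2 <= f x)%N}].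
Proof.
move=> m_graph f_gt0 f_deg.
(* A crude common bound, only to make the index type of copies and halves large enough. *)
pose N := (\sum_x f x + \sum_x \sum_y m x y)%N.
have f_bound x : (f x <= N.+1)%N.
  by rewrite /N (bigD1 x) //= -!addnA leqW ?leq_addr.
have m_bound x y : (m x y <= N.+1)%N.
  rewrite /N [X in (_ + X)%N](bigD1 x) //= [X in (_ + (X + _))%N](bigD1 y) //=; lia.
pose b := odd (\sum_x f x).
pose X := gadget_set m f N b.
have evX : ~~ odd #|X| by apply: odd_gadget_set.
have [/existsP[M /andP[mM /forallP pM]]|hX] := boolP
    [exists M, matching (@gadget V N) X M && [forall w, (w \in X) ==> (M w != w)]].
  left; apply: (near_factor_of_perfect m_graph f_bound m_bound mM) => w wX.
  by have := pM w; rewrite wX.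
right.
have [|A [sA leA minA]] := minimal_barrier (@gadget_sym V N) evX.
  apply: tutte evX => [|M mM]; first exact: gadget_sym.
  move: hX; rewrite negb_exists => /forallP/(_ M); rewrite mM negb_forall => /existsP[w].
  by rewrite negb_imply negbK => /andP[wX /eqP Mw]; exists w.
exists [set x | inl (inl (x, ord0)) \in A].
exists [set x | halves m N (fun a _ => a == x) \subset A].
split=> [x xT||x xT].
- exact: (disjoint_ST f_bound m_bound f_gt0 f_deg sA leA minA).
- exact: (barrier_count m_graph f_bound m_bound f_gt0 f_deg sA leA minA).
- exact: (degree_in_T m_graph f_bound m_bound f_gt0 f_deg sA leA minA).
Qed.

(** * Components and iso-toughness *)

Section Components.
Variables (V : finType) (m : V -> V -> nat).
Hypothesis m_sym : forall x y, m x y = m y x.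
Implicit Types (S W : {set V}).

Lemma adj_del_connect_sym S : connect_sym (adj_del m S).
Proof. by apply: sym_connect_sym => x y; rewrite /adj_del andbCA m_sym. Qed.

(** Putting [v] back merges only the components that contain a neighbour of [v], whose roots form
    [D]. The others survive, and the component of [v] is one more. *)
Lemma ncomp_del_setU1 v S : v \notin S ->
  (ncomp_del m (v |: S) + 1 <= ncomp_del m S + \sum_(u | u \notin S) m v u)%N.
Proof.
move=> vS; pose e1 := adj_del m S; pose e2 := adj_del m (v |: S).
have sym1 : connect_sym e1 := adj_del_connect_sym S.
have sym2 : connect_sym e2 := adj_del_connect_sym (v |: S).
have e12 x z : x != v -> z != v -> e1 x z -> e2 x z.
  by move=> xv zv; rewrite /e1 /e2 /adj_del !inE !negb_or xv zv.
pose R1 := [set r | (r \in roots e1) && (r \notin S)].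
pose R2 := [set r | (r \in roots e2) && (r \notin v |: S)].
have -> : ncomp_del m S = #|R1|.
  by apply: eq_card => r; rewrite [RHS]in_set !inE.
have -> : ncomp_del m (v |: S) = #|R2|.
  by apply: eq_card => r; rewrite [RHS]in_set !inE.
pose Nb := [set u | (u \notin S) && (0 < m v u)%N].
pose D := root e2 @: Nb.
have cNb : (#|R2 :&: D| <= \sum_(u | u \notin S) m v u)%N.
  apply: (@leq_trans #|Nb|).
    by apply: leq_trans (leq_imset_card (root e2) Nb); rewrite subset_leq_card ?subsetIr.
  rewrite -sum1dep_card big_mkcondr; apply: leq_sum => u _.
  by case: (m v u).
have nconn r : r \in R2 :\: D -> ~~ connect e1 v r.
  rewrite in_setD [r \in R2]in_set => /andP[rD /andP[/eqP rr]].
  rewrite in_setU1 negb_or => /andP[rv rS].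
  (* A path without repetition from [v] never returns to [v], so after its first step [u] it runs in
     the graph without [v]. *)
  apply: contra rD => /connectP[p /shortenP[[|u p'] /= pp up _ lr]].
    by rewrite lr eqxx in rv.
  case/andP: pp => /and3P[_ uS mu] pp; case/andP: up => vnu _.
  apply/imsetP; exists u; first by rewrite in_set uS.
  rewrite -rr; apply/esym/(rootP sym2); rewrite lr.
  elim: p' u pp vnu {mu uS lr} => [|z p' IH] u /=; first by rewrite connect0.
  case/andP=> euz pz; rewrite !inE !negb_or => /and3P[vu vz vp].
  apply: connect_trans (IH z pz _); last by rewrite inE negb_or vz.
  by apply: connect1; apply: e12; rewrite // eq_sym.
have conn12 x y : ~~ connect e1 v x -> connect e1 x y -> connect e2 x y.
  move=> nx /connectP[p pp ->]; elim: p x nx pp => [|z p IH] x nx /=; first by rewrite connect0.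
  case/andP=> exz pz; have nz : ~~ connect e1 v z.
    by apply: contra nx => cz; rewrite (connect_trans cz) // sym1 connect1.
  apply: connect_trans (IH z nz pz); apply/connect1/e12 => //.
    by apply: contraNneq nx => ->; rewrite connect0.
  by apply: contraNneq nz => ->; rewrite connect0.
have cR : (#|v |: (R2 :\: D)| <= #|R1|)%N.
  have vnot : v \notin R2 :\: D by apply/negP => /nconn; rewrite connect0.
  rewrite -(card_in_imset (f := root e1) (D := mem (v |: (R2 :\: D)))).
    apply/subset_leq_card/subsetP => _ /imsetP[r rI ->]; rewrite in_set.
    apply/andP; split; first exact: roots_root.
    have rS : r \notin S.
      case/setU1P: rI => [->//|]; rewrite in_setD [r \in R2]in_set => /and3P[_ _].
      by rewrite in_setU1 negb_or => /andP[].
    have cl : closed e1 (~: S).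
      by apply: (intro_closed sym1) => x y /and3P[_ yS _] _; rewrite in_setC.
    by rewrite -in_setC -(closed_connect cl (connect_root _ _)) in_setC.
  move=> r r' rI r'I /(rootP sym1) crr'.
  case/setU1P: rI crr' => [->|rI] crr'; case/setU1P: r'I crr' => [->|r'I] crr' //.
  - by case/negP: (nconn _ r'I).
  - by case/negP: (nconn _ rI); rewrite sym1.
  have := conn12 _ _ (nconn _ rI) crr' => /(rootP sym2).
  move: rI r'I; rewrite !in_setD [r \in R2]in_set [r' \in R2]in_set.
  by move=> /and3P[_ /eqP-> _] /and3P[_ /eqP-> _].
move: cR; rewrite cardsU1.
have -> : v \notin R2 :\: D by apply/negP => /nconn; rewrite connect0.
by have := cardsID D R2; lia.
Qed.

Lemma ncomp_del_setU S W : {in W, forall v, v \notin S} ->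
  (ncomp_del m (S :|: W) + #|W| <= ncomp_del m S + \sum_(v in W) \sum_(u | u \notin S) m v u)%N.
Proof.
have [n] := ubnP #|W|; elim: n W => // n IH W ltW hW.
have [->|[v vW]] := set_0Vmem W; first by rewrite setU0 cards0 big_set0.
have ltW' : (#|W :\ v| < n)%N by move: ltW; rewrite (cardsD1 v) vW.
have := IH _ ltW'; move=> /(_ (fun x xW => hW x (subsetP (subsetDl W [set v]) x xW))) le.
have -> : S :|: W = v |: (S :|: W :\ v) by rewrite setUCA setD1K.
rewrite (big_setD1 v vW) /= (cardsD1 v W) vW.
have := @ncomp_del_setU1 v (S :|: W :\ v); rewrite in_setU setD11 orbF hW // => /(_ isT).
have : (\sum_(u | u \notin S :|: W :\ v) m v u <= \sum_(u | u \notin S) m v u)%N.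
  rewrite [leqLHS]big_mkcond [leqRHS]big_mkcond; apply: leq_sum => u _.
  by rewrite in_setU negb_or; case: (u \in S) => //=; case: ifP.
by move: le; lia.
Qed.

(* Greedily pick a vertex of largest [f] and discard its neighbours. *)
Lemma independent_subset (f : V -> nat) W : (forall x, m x x = 0%N) ->
  exists I : {set V}, [/\ I \subset W, {in I &, forall x y, m x y = 0%N} &
    (\sum_(v in W) f v <= \sum_(v in I) f v * (1 + \sum_(u in W) m v u))%N].
Proof.
move=> m_irr; have [n] := ubnP #|W|; elim: n W => // n IH W ltW.
have [->|[v0 v0W]] := set_0Vmem W.
  by exists set0; split; [exact: sub0set | move=> x y; rewrite inE | rewrite !big_set0].
have [v vW vmax] := arg_maxnP f v0W.
pose W' := [set u in W | (u != v) && (m v u == 0%N)].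
have sW' : W' \subset W by apply/subsetP => u; rewrite inE => /andP[].
have ltW' : (#|W'| < n)%N.
  rewrite -ltnS; apply: leq_trans ltW; rewrite ltnS; apply/proper_card/properP; split=> //.
  by exists v => //; rewrite inE eqxx andbF.
have [I [sI iI leI]] := IH _ ltW'.
have vI : v \notin I by apply/negP => /(subsetP sI); rewrite inE eqxx andbF.
have mvI u : u \in I -> m v u = 0%N by move=> /(subsetP sI); rewrite inE => /and3P[_ _ /eqP].
exists (v |: I); split.
- by apply/subsetP => u /setU1P[->//|/(subsetP sI)/(subsetP sW')].
- by move=> x y /setU1P[->|xI] /setU1P[->|yI]; rewrite ?m_irr ?mvI // 1?m_sym ?mvI // iI.
rewrite (big_setU1 _ vI) /= (big_setID W') /= (setIidPr sW') addnC leq_add //.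
  rewrite (bigD1 v) ?inE ?vW ?eqxx ?andbF //= mulnDr muln1 leq_add2l big_distrr /=.
  (* By the choice of [v], a discarded neighbour [u] satisfies [f u <= f v <= f v * m v u]. *)
  apply: (@leq_trans (\sum_(u in W) if (u \notin W') && (u != v) then f u else 0)%N).
    rewrite -big_mkcondr /=; apply/eq_leq/eq_bigl => u; rewrite in_setD.
    by rewrite [in RHS]andbA [(u \in W) && _]andbC.
  apply: leq_sum => u uW; rewrite inE uW /=; case: ifP => // /andP[h uv].
  move: h; rewrite uv /= -lt0n => mu; apply: leq_trans (vmax u uW) _.
  by rewrite leq_pmulr.
apply: leq_trans leI _; apply: leq_sum => u _; rewrite leq_mul2l leq_add2l.
apply/orP; right; rewrite [leqRHS](big_setID W') /= (setIidPr sW'); exact: leq_addr.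
Qed.
End Components.

(** * Iso-toughness on independent sets and the final estimate *)

Local Open Scope ring_scope.

(** Deleting [S] and the set [Q] of neighbours of [I] outside [S] isolates all of [I], and [Q] has
    at most as many vertices as there are edges from [I] to it. *)
Lemma iso_tough_independent (R : realFieldType) (T : finType) (m : T -> T -> nat)
    (t : T -> R) (S I : {set T}) :
  multigraph m -> iso_tough m t -> (forall v, 0 <= t v) ->
  {in I, forall x, x \notin S} -> {in I &, forall x y, m x y = 0%N} ->
  \sum_(v in I) t v <= (#|S| + \sum_(v in I) \sum_(u | u \notin S) m v u)%N%:R.
Proof.
move=> [m_sym _] tough t0 IS indI.
pose Q := [set u | (u \notin S) && [exists v in I, (0 < m v u)%N]].
have sI : I \subset iso_del m (S :|: Q).
  apply/subsetP => v vI; rewrite inE in_setU negb_or IS //=; apply/andP; split.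
    rewrite inE IS //=; apply/existsP => -[w /andP[wI]]; by rewrite indI.
  apply/forallP => u; apply/implyP => mu; rewrite in_setU in_set.
  case: (u \in S) => //=; apply/existsP; exists v; by rewrite vI.
have cQ : (#|Q| <= \sum_(v in I) \sum_(u | u \notin S) m v u)%N.
  rewrite exchange_big -sum1dep_card big_mkcondr; apply: leq_sum => u _.
  case: ifP => // /existsP[v /andP[vI mv]]; rewrite (bigD1 v) //=.
  exact: leq_trans mv (leq_addr _ _).
apply: (@le_trans _ _ (\sum_(v in iso_del m (S :|: Q)) t v)).
  rewrite [leRHS](big_setID I) /= (setIidPr sI) lerDl; exact: sumr_ge0.
apply: le_trans (tough _) _; rewrite ler_nat.
by apply: leq_trans (leq_card_setU _ _) _; rewrite leq_add2l.
Qed.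

Theorem mainTheorem4 (R : realFieldType) (T : finType) (m : T -> T -> nat)
  (f : T -> nat) (eps : R) :
  multigraph m ->
  (forall v, (0 < f v)%N) ->
  0 < eps -> eps <= 1 ->
  iso_tough m (fun v => ((f v * (f v).+1)%N)%:R / eps) ->
  (forall S : {set T},
     (ncomp_del m S)%:R < \sum_(v in S) ((f v)%:R - eps) + 2%:R) ->
  near_factor m f.
Proof.
move=> m_graph f_gt0 eps0 eps1 tough comps.
have [m_sym m_irr] := m_graph.
have t0 v : 0 <= ((f v * (f v).+1)%N)%:R / eps by rewrite divr_ge0 ?ler0n // ltW.
(* The denominator [eps] is cleared; as [eps <= 1], the factor may be dropped from the degree term
   but is kept on [#|S|]. *)
have toughI (S I : {set T}) : {in I, forall x, x \notin S} ->
    {in I &, forall x y, m x y = 0%N} ->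
    (\sum_(v in I) (f v * (f v).+1))%:R <=
      eps * #|S|%:R + (\sum_(v in I) \sum_(u | u \notin S) m v u)%:R.
  move=> IS indI; have := iso_tough_independent m_graph tough t0 IS indI.
  rewrite -mulr_suml ler_pdivrMr // natrD mulrDl -natr_sum => le.
  apply: le_trans le _; rewrite mulrC lerD2l ler_piMr // ler0n.
(* Toughness for the independent set consisting of [v] alone, with [S] empty. *)
have f_deg v : (f v <= deg m v)%N.
  have := toughI set0 [set v]; rewrite !big_set1 cards0 mulr0 add0r => h.
  have {h} : (f v * (f v).+1 <= \sum_(u | u \notin set0) m v u)%N.
    by rewrite -(ler_nat R) h // => [x|x y /set1P-> /set1P->]; rewrite ?inE ?m_irr.
  rewrite (eq_bigl predT) => [le|u]; last by rewrite inE.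
  by apply: leq_trans le; rewrite leq_pmulr.
have [//|[S [W0 [disj count deg_in]]]] := near_factor_or_barrier m_graph f_gt0 f_deg.
pose d v := (\sum_(u | u \notin S) m v u)%N.
(* The vertices of [U] are deleted together with [S], those of [W] are put back
   one at a time, each merging at most [d v] components. *)
pose U := [set v in W0 | (2 * f v <= d v)%N].
pose W := W0 :\: U.
have sU : U \subset W0 by apply/subsetP => v; rewrite inE => /andP[].
have W0E (F : T -> nat) : (\sum_(v in W0) F v = \sum_(v in U) F v + \sum_(v in W) F v)%N.
  by rewrite (big_setID U) /= (setIidPr sU).
(* For [v] in [U], [d v - f v] is at least [f v], which brings the sum over [U] to the left; the
   degree terms over [W] pay for the merged components. *)
have bound : (\sum_(v in S) f v + \sum_(v in U) f v + 2 <=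
    \sum_(v in W) f v + ncomp_del m (S :|: U))%N.
  have UW : U :|: W = W0 by rewrite -[RHS](setID W0 U) (setIidPr sU).
  have WSU : {in W, forall v, v \notin S :|: U}.
    by move=> v; rewrite in_setD in_setU negb_or => /andP[-> /disj->].
  have := ncomp_del_setU m_sym WSU; rewrite -setUA UW.
  have : (\sum_(v in W) \sum_(u | u \notin S :|: U) m v u <= \sum_(v in W) d v)%N.
    apply: leq_sum => v _; rewrite [leqLHS]big_mkcond [leqRHS]big_mkcond.
    by apply: leq_sum => u _; rewrite in_setU negb_or; case: (u \in S) => //=; case: ifP.
  have : (\sum_(v in U) (2 * f v) <= \sum_(v in U) d v)%N.
    by apply: leq_sum => v; rewrite inE => /andP[].
  rewrite -big_distrr /=.
  by move: count; rewrite (W0E f) (W0E d); lia.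
(* The component hypothesis for [S :|: U] gives this even with [#|S| + #|U|] in place of [#|S|]. *)
have epsS : eps * #|S|%:R < (\sum_(v in W) f v)%:R.
  have disjSU : [disjoint S & U].
    by rewrite disjoint_sym disjoint_subset; apply/subsetP => v /(subsetP sU)/disj.
  have cSU : #|S :|: U| = (#|S| + #|U|)%N by apply/eqP; rewrite (leq_card_setU S U).2.
  have := comps (S :|: U); rewrite sumrB sumr_const -natr_sum cSU.
  rewrite (eq_bigl [predU S & U]) ?bigU //=; last by move=> v; rewrite in_setU.
  rewrite -[eps *+ _]mulr_natr addrAC -natrD ltrBrDr => lt.
  rewrite -(ltrD2r (ncomp_del m (S :|: U))%:R) -natrD.
  apply: (@lt_le_trans _ _ (\sum_(v in S) f v + \sum_(v in U) f v + 2)%N%:R).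
    by apply: le_lt_trans lt; rewrite addrC lerD2l (ler_wpM2l (ltW eps0)) // ler_nat leq_addr.
  by rewrite ler_nat.
have [I [sI indI leI]] := independent_subset m_sym f W m_irr.
have IS : {in I, forall x, x \notin S}.
  by move=> x /(subsetP sI); rewrite in_setD => /andP[_ /disj].
(* Termwise, at most f(v) - 2 edges go from [v] into [W] and [d v] is at most 2f(v) - 1, so the sum
   is at most f(v)(f(v) - 1) + 2f(v) - 1. *)
have leW : (\sum_(v in W) f v + \sum_(v in I) d v <= \sum_(v in I) f v * (f v).+1)%N.
  apply: (leq_trans (leq_add leI (leqnn _))); rewrite -big_split /=.
  apply: leq_sum => v /(subsetP sI) vW.
  have vW0 : v \in W0 by apply: subsetP vW; apply: subsetDl.
  have dv : (d v < 2 * f v)%N.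
    by move: vW; rewrite in_setD vW0 andbT inE vW0 -ltnNge.
  have := deg_in v vW0.
  have : (\sum_(u in W) m v u <= \sum_(u in W0) m v u)%N by rewrite (W0E (m v)) leq_addl.
  by nia.
have lt : eps * #|S|%:R + (\sum_(v in I) d v)%:R <
    (\sum_(v in W) f v + \sum_(v in I) d v)%N%:R by rewrite natrD ltrD2r.
by have := le_lt_trans (toughI S I IS indI) lt; rewrite ltr_nat ltnNge leW.
Qed.
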